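(* Let $H=(V,E)$ be an oriented hypergraph that has an algebraic spanning tree over the integers. Then $H_1\cong H^1$ over the integers.
   Context: An oriented hypergraph $H=(V,E)$ consists of a finite set $V$ and a set $E$ of ordered pairs $(A,B)$ of disjoint subsets of $V$, where $E$ never contains both $(A,B)$ and $(B,A)$. $C_0,C_1$ are the free $\mathbb Z$-modules with bases $V,E$; $\partial_1\colon C_1\to C_0$ is the linear extension of $(A,B)\mapsto\sum_{v\in B}v-\sum_{v\in A}v$; $C^0=\mathrm{Hom}(C_0,\mathbb Z)$, $C^1=\mathrm{Hom}(C_1,\mathbb Z)$; $\delta^0(\varphi)=\varphi\circ\partial_1$. $H_1:=\operatorname{Ker}\partial_1$ and $H^1:=C^1/\operatorname{Im}\delta^0$. $\gamma_1\colon C_1\to C^1$ with $\gamma_1(e)(e')=\delta_{ee'}$; $\langle\,,\rangle$ is the bilinear form on $C_1$ with $\langle e,e'\rangle=\delta_{ee'}$; $\mathcal C:=\operatorname{Ker}\partial_1$, $\mathcal B:=\gamma_1^{-1}(\operatorname{Im}\delta^0)$. $T\subseteq E$ is an algebraic spanning tree over the integers if (1) $\mathcal B$ has a $\mathbb Z$-basis $(x_t\mid t\in T)$ with $\langle x_t,t'\rangle=\delta_{tt'}$ for all $t,t'\in T$, and (2) $\mathcal C$ has a $\mathbb Z$-basis $(x_e\mid e\in E\setminus T)$ with $\langle x_e,e'\rangle=\delta_{ee'}$ for all $e,e'\in E\setminus T$. *)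

(* Defs.v *)
From HB Require Import structures.
From mathcomp Require Import all_boot all_algebra.
From mathcomp Require Import boolp.

Set Implicit Arguments.
Unset Strict Implicit.
Unset Printing Implicit Defensive.

Import GRing.Theory.
Local Open Scope ring_scope.

(* Taken literally, [hedge_asym] also excludes the pair (set0, set0), which is
   its own reverse. *)
Record oriHypergraph := OriHypergraph {
  vertex : finType;
  hedges : {set {set vertex} * {set vertex}};
  hedge_disjoint : forall A B, (A, B) \in hedges -> [disjoint A & B];
  hedge_asym : forall A B, ~ ((A, B) \in hedges /\ (B, A) \in hedges)
}.

Definition edge (H : oriHypergraph) : finType := {e | e \in hedges H}.

(* [int^o] is [int] seen as a module over itself. *)
Definition freeZ (I : finType) := {ffun I -> int^o}.
HB.instance Definition _ I := Vector.on (freeZ I).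

Definition bvec (I : finType) (i : I) : freeZ I := [ffun j => (j == i)%:R].

Section LinearExtension.
Variables (I : finType) (M : vectType int) (f : I -> M).

Definition linext_fun (a : freeZ I) : M := \sum_i (a i : int) *: f i.

Lemma linext_fun_is_linear : linear linext_fun.
Proof.
move=> k a b; rewrite /linext_fun scaler_sumr -big_split /=.
by apply: eq_bigr => i _; rewrite !ffunE scalerDl scalerA.
Qed.

HB.instance Definition _ :=
  GRing.isLinear.Build int (freeZ I) M *:%R linext_fun linext_fun_is_linear.

Definition linext : 'Hom(freeZ I, M) := linfun linext_fun.

Lemma linext_bvec i : linext (bvec i) = f i.
Proof.
rewrite lfunE /= /linext_fun (bigD1 i) //= !ffunE eqxx scale1r big1 ?addr0 //.
by move=> j ji; rewrite ffunE (negbTE ji) scale0r.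
Qed.

End LinearExtension.

Definition pairing (I : finType) (x y : freeZ I) : int :=
  \sum_i (x i : int) * y i.

Lemma pairing_bvec (I : finType) (i j : I) : pairing (bvec i) (bvec j) = (i == j)%:R.
Proof.
rewrite /pairing (bigD1 i) //= big1 => [|k ki].
  by rewrite [LHS]addr0 !ffunE eqxx mul1r.
by rewrite !ffunE (negbTE ki) mul0r.
Qed.

Section IntegralBasis.
Variables (M : lmodType int) (S : {pred M}) (I : finType).

Definition is_Zbasis (x : I -> M) : Prop :=
  [/\ forall i, x i \in S,
      forall a : I -> int, \sum_i a i *: x i = 0 -> forall i, a i = 0 &
      forall y, y \in S -> exists a : I -> int, y = \sum_i a i *: x i].

End IntegralBasis.

Section ChainComplex.
Variable H : oriHypergraph.

Definition chain0 : vectType int := freeZ (vertex H).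
Definition chain1 : vectType int := freeZ (edge H).
Definition cochain0 : vectType int := 'Hom(chain0, int^o).
Definition cochain1 : vectType int := 'Hom(chain1, int^o).

Definition bd1 : 'Hom(chain1, chain0) :=
  linext (fun e : edge H =>
    \sum_(v in (val e).2) bvec v - \sum_(v in (val e).1) bvec v : chain0).

Definition cobd0 (phi : cochain0) : cochain1 := (phi \o bd1)%VF.

Definition ker_bd1 : {pred chain1} := fun x => bd1 x == 0.
Definition im_cobd0 : {pred cochain1} := fun psi => `[< exists phi, psi = cobd0 phi >].

Lemma ker_bd1_zmod_closed : zmod_closed ker_bd1.
Proof.
split=> [|x y]; rewrite !unfold_in /ker_bd1 ?linear0 // => /eqP x0 /eqP y0.
by rewrite linearB /= x0 y0 subrr.
Qed.

HB.instance Definition _ :=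
  GRing.isZmodClosed.Build chain1 ker_bd1 ker_bd1_zmod_closed.

Lemma im_cobd0_zmod_closed : zmod_closed im_cobd0.
Proof.
split=> [|x y]; rewrite !unfold_in /im_cobd0.
  by apply/asboolP; exists 0; rewrite /cobd0 comp_lfun0l.
move=> /asboolP[f ->] /asboolP[g ->]; apply/asboolP; exists (f - g).
by rewrite /cobd0 comp_lfunDl comp_lfunNl.
Qed.

HB.instance Definition _ :=
  GRing.isZmodClosed.Build cochain1 im_cobd0 im_cobd0_zmod_closed.

Record homology1 := HomologyClass { cycle_val : chain1; _ : cycle_val \in ker_bd1 }.
HB.instance Definition _ := [isSub for cycle_val].
HB.instance Definition _ := [Choice of homology1 by <:].
HB.instance Definition _ := [SubChoice_isSubZmodule of homology1 by <:].

Definition cohomology1 : zmodType := Quotient.quot im_cobd0.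

Definition gamma1 : 'Hom(chain1, cochain1) :=
  linext (fun e : edge H => linext (fun e' : edge H => (e == e')%:R : int^o) : cochain1).

Definition cycles : {pred chain1} := ker_bd1.
Definition cobounds : {pred chain1} := [pred x | gamma1 x \in im_cobd0].

Definition has_dual_Zbasis (S : {pred chain1}) (U : {set edge H}) : Prop :=
  exists x : {e | e \in U} -> chain1,
    is_Zbasis S x /\
    forall e e' : {e | e \in U}, pairing (x e) (bvec (val e')) = (e == e')%:R.

Definition alg_spanning_tree (T : {set edge H}) : Prop :=
  has_dual_Zbasis cobounds T /\ has_dual_Zbasis cycles (~: T).

End ChainComplex.

Arguments ker_bd1 H x : clear implicits.
Arguments im_cobd0 H psi : clear implicits.
Arguments cycles H x : clear implicits.
Arguments cobounds H x : clear implicits.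

(* Z-linear maps are exactly the additive ones. *)
Definition Zisomorphic (M N : zmodType) : Prop :=
  exists f : {additive M -> N}, bijective f.

(* Main.v *)
From HB Require Import structures.
Require Import Defs.
From mathcomp Require Import all_boot all_algebra.
From mathcomp Require Import boolp.

(** If [S] has a basis dual to [U], restriction to the coordinates in [U] is a
    bijection from [S] onto the integer functions on [U].  Applied to the
    coboundaries, with [U = T], this identifies the quotient [H^1] with the
    functions on the complement of [T]; applied to the cycles it identifies
    [H_1] with the same module.  The isomorphism sends a cycle to the class of
    its truncation to the complement of [T]. *)

Set Implicit Arguments.
Unset Strict Implicit.
Unset Printing Implicit Defensive.

Import GRing.Theory.
Local Open Scope ring_scope.

Lemma pairing_bvecr (I : finType) (x : freeZ I) i : pairing x (bvec i) = x i.
Proof.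
rewrite /pairing (bigD1 i) //= big1 => [|k ki].
  by rewrite [LHS]addr0 ffunE eqxx mulr1.
by rewrite ffunE (negbTE ki) mulr0.
Qed.

Lemma freeZ_sum_bvec (I : finType) (x : freeZ I) : x = \sum_i (x i : int) *: bvec i.
Proof.
apply/ffunP => j; rewrite sum_ffunE (bigD1 j) //= big1 => [|k kj].
  by rewrite !ffunE eqxx [RHS]addr0; exact/esym/mulr1.
by rewrite !ffunE eq_sym (negbTE kj) scaler0.
Qed.

Lemma eq_freeZ_hom (I : finType) (M : vectType int) (f g : 'Hom(freeZ I, M)) :
  (forall i, f (bvec i) = g (bvec i)) -> f = g.
Proof.
move=> fg; apply/lfunP => x; rewrite (freeZ_sum_bvec x) !linear_sum.
by apply: eq_bigr => i _; rewrite !linearZ /= fg.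
Qed.

Section Hypergraph.
Variable H : oriHypergraph.

Lemma gamma1_bvec (x : chain1 H) e : gamma1 H x (bvec e) = x e.
Proof.
rewrite {1}(freeZ_sum_bvec x) linear_sum sum_lfunE.
rewrite (bigD1 e) //= big1 => [|k ke].
  by rewrite linearZ /= lfunE /= !linext_bvec eqxx [LHS]addr0; exact: mulr1.
by rewrite linearZ /= lfunE /= !linext_bvec (negbTE ke) scaler0.
Qed.

(** A cochain is determined by its values on the edges, and the witness has these values as
    coefficients. Every class of [cohomology1] thus has a representative in [chain1]. *)
Lemma gamma1_surj (psi : cochain1 H) : exists x, gamma1 H x = psi.
Proof.
exists [ffun e => psi (bvec e)]; apply: eq_freeZ_hom => e.
by rewrite gamma1_bvec ffunE.
Qed.

Lemma cobounds_zmod_closed : zmod_closed (cobounds H).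
Proof.
split=> [|x y]; rewrite !inE ?linear0 ?rpred0 // => xB yB.
by rewrite linearB rpredB.
Qed.

HB.instance Definition _ :=
  GRing.isZmodClosed.Build (chain1 H) (cobounds H) cobounds_zmod_closed.

HB.instance Definition _ :=
  GRing.isZmodClosed.Build (chain1 H) (cycles H) (ker_bd1_zmod_closed H).

Lemma dual_Zbasis_coord (U : {set edge H})
    (x : {e | e \in U} -> chain1 H) (a : {e | e \in U} -> int) :
  (forall e e', pairing (x e) (bvec (val e')) = (e == e')%:R) ->
  forall e, (\sum_i a i *: x i) (val e) = a e.
Proof.
move=> xd e; rewrite sum_ffunE (bigD1 e) //= big1 => [|k ke].
  by rewrite [LHS]addr0 ffunE -pairing_bvecr xd eqxx; exact: mulr1.
by rewrite ffunE -pairing_bvecr xd (negbTE ke) scaler0.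
Qed.

(** By duality, the coefficients of [y] in the basis are its own coordinates on [U]. This is
    injectivity of restriction to [U]. *)
Lemma dual_Zbasis_eq0 (S : {pred chain1 H}) (U : {set edge H}) (y : chain1 H) :
  has_dual_Zbasis S U -> y \in S -> {in U, forall e, y e = 0} -> y = 0.
Proof.
move=> [x [[_ _ xgen] xd]] /xgen[a ya] y0.
rewrite ya big1 // => e _.
by rewrite -(dual_Zbasis_coord a xd e) -ya y0 ?scale0r ?(valP e).
Qed.

(** Surjectivity of restriction to [U]: the values of [y] on [U] serve as coefficients, and [y]
    itself may lie outside [S]. *)
Lemma dual_Zbasis_interp (S : zmodClosed (chain1 H)) (U : {set edge H})
    (y : chain1 H) :
  has_dual_Zbasis S U -> exists2 z, z \in S & {in U, z =1 y}.
Proof.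
move=> [x [[xS _ _] xd]].
exists (\sum_i (y (val i) : int) *: x i).
  by apply: rpred_sum => i _; rewrite -[y _ : int]intz scaler_int rpredMz.
by move=> e eU; rewrite (dual_Zbasis_coord _ xd (exist _ e eU)).
Qed.

Definition truncate (U : {set edge H}) (x : chain1 H) : chain1 H :=
  [ffun e => if e \in U then x e else 0].

Lemma truncate_is_zmod_morphism U : zmod_morphism (truncate U).
Proof.
by move=> x y; apply/ffunP => e; rewrite !ffunE; case: ifP; rewrite ?subr0.
Qed.

HB.instance Definition _ U :=
  GRing.isZmodMorphism.Build (chain1 H) (chain1 H) (truncate U)
    (truncate_is_zmod_morphism U).

Definition cocycle_class (U : {set edge H}) (c : homology1 H) : cohomology1 H :=
  \pi_(cohomology1 H)%qT (gamma1 H (truncate U (val c))).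

Lemma cocycle_class_is_zmod_morphism U : zmod_morphism (cocycle_class U).
Proof. by move=> x y; rewrite /cocycle_class !raddfB. Qed.

HB.instance Definition _ U :=
  GRing.isZmodMorphism.Build (homology1 H) (cohomology1 H) (cocycle_class U)
    (cocycle_class_is_zmod_morphism U).

Lemma eq_cohomology_class (x y : chain1 H) :
  (\pi_(cohomology1 H)%qT (gamma1 H x) == \pi_(cohomology1 H)%qT (gamma1 H y))
  = (x - y \in cobounds H).
Proof. by rewrite -Quotient.idealrBE -linearB. Qed.

End Hypergraph.

Theorem theorem13 (H : oriHypergraph)
    (hT : exists T : {set edge H}, alg_spanning_tree T) :
  Zisomorphic (homology1 H) (cohomology1 H).
Proof.
have [T [hB hC]] := hT.
exists (cocycle_class (~: T)).
have inj : injective (cocycle_class (~: T)).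
  apply: raddf_inj => c /eqP.
  rewrite -(raddf0 (cocycle_class (~: T))) eq_cohomology_class -raddfB subr0.
  move=> /(dual_Zbasis_eq0 hB) c0.
  (* The truncation lies in [cobounds] and vanishes on [T], so it is zero. *)
  have {}c0 : truncate (~: T) (val c) = 0.
    by apply: c0 => t tT; rewrite ffunE inE tT.
  (* Hence the cycle vanishes off [T], where its coordinates determine it. *)
  apply: val_inj; apply: (dual_Zbasis_eq0 hC (valP c)) => e eT.
  by move/ffunP/(_ e): c0; rewrite !ffunE eT.
have surj q : exists c, cocycle_class (~: T) c = q.
  have [y yq] := gamma1_surj (repr q).
  (* Subtracting the coboundary [b] keeps the class of [y] and makes the representative vanish on
     [T]. *)
  have [b bB yb] := dual_Zbasis_interp y hB.
  (* The cycle [c] matches [y - b] off [T], so its truncation is exactly [y - b]. *)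
  have [c cC cy] := dual_Zbasis_interp (y - b) hC.
  exists (HomologyClass cC); rewrite -[q]reprK -yq.
  apply/eqP; rewrite eq_cohomology_class /=.
  suff -> : truncate (~: T) c - y = - b by rewrite rpredN.
  apply/ffunP => e; rewrite !ffunE; case: ifPn => [eT|].
    by rewrite cy // !ffunE addrAC subrr add0r.
  by rewrite inE negbK => eT; rewrite yb // sub0r.
(* Choosing preimages gives a right inverse, which injectivity makes two-sided. *)
have [g gK] := choice surj.
by exists g => // c; apply: inj; rewrite gK.
Qed.
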